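(* Let $\mathcal{C}$ be a $(\mathrm{fam},\Sigma)$-category with a terminal object $1$, let $a$ be an object of $\mathcal{C}$, let $\lambda \in \mathrm{fHom}(a)$, and let $i, j \colon 1 \to a$ be global elements of $a$. Write $\lambda(i) := \lambda \circ i$ and $\lambda(j) := \lambda\circ j$, both in $\mathrm{fHom}(1)$. Then the following hold. (i) $\sum_1 \lambda(i)$ is a subobject of $\sum_a \lambda$ via $\Sigma_\lambda i \colon \sum_1 \lambda(i) \to \sum_a\lambda$ (i.e. $\Sigma_\lambda i$ is a monomorphism), and $\mathrm{pr}_1^{1,\lambda(i)}$ is the unique arrow $! \colon \sum_1 \lambda(i) \to 1$. (ii) If $i = j$, there are transport arrows $\lambda_{ij} \colon \sum_1 \lambda(i) \to \sum_1\lambda(j)$ and $\lambda_{ji} \colon \sum_1\lambda(j) \to \sum_1\lambda(i)$, which form an isomorphism (i.e. they are inverse to each other).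
   Context: A category $\mathcal{C}$ (with objects $C_0$ and arrows $C_1$) is a fam-category if: (a) every object $a$ has an associated collection $\mathrm{fHom}(a)$ of ''family-arrows''; (b) for all objects $a,b$ there is an operation $\mathrm{fHom}(a)\times \mathrm{Hom}(b,a)\to \mathrm{fHom}(b)$, $(\lambda,f)\mapsto \lambda\circ f$, with $\lambda\circ 1_a=\lambda$ and $\lambda\circ(f\circ g)=(\lambda\circ f)\circ g$ for all $\lambda\in\mathrm{fHom}(a)$, $f\in\mathrm{Hom}(b,a)$, $g\in\mathrm{Hom}(c,b)$. A $(\mathrm{fam},\Sigma)$-category is a fam-category $\mathcal{C}$ equipped with: for every object $a$ and $\lambda\in\mathrm{fHom}(a)$, an object $\sum_a\lambda$ and an arrow $\mathrm{pr}_1^{a,\lambda}\colon\sum_a\lambda\to a$; and for every $f\in\mathrm{Hom}(b,a)$ and $\lambda\in\mathrm{fHom}(a)$, an arrow $\Sigma_\lambda f\colon\sum_b(\lambda\circ f)\to\sum_a\lambda$ such that the commutative square $\mathrm{pr}_1^{a,\lambda}\circ\Sigma_\lambda f=f\circ\mathrm{pr}_1^{b,\lambda\circ f}$ is a pullback (of $\mathrm{pr}_1^{a,\lambda}$ along $f$), and the following strictness conditions hold: $\Sigma_\lambda 1_a=1_{\sum_a\lambda}$, and $\Sigma_\lambda(f\circ g)=(\Sigma_\lambda f)\circ\Sigma_{(\lambda\circ f)}g$ for all $f\in\mathrm{Hom}(b,a)$, $g\in\mathrm{Hom}(c,b)$. Transport arrows: for global elements $i=j$ of $a$, a transport arrow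 $\lambda_{ij}\colon\sum_1\lambda(i)\to\sum_1\lambda(j)$ is an arrow with $(\Sigma_\lambda j)\circ\lambda_{ij}=\Sigma_\lambda i$ and ${!!}\circ\lambda_{ij}={!}$, where $!\colon\sum_1\lambda(i)\to 1$ and $!!\colon\sum_1\lambda(j)\to1$ are the unique arrows to $1$; similarly $\lambda_{ji}\colon\sum_1\lambda(j)\to\sum_1\lambda(i)$ is an arrow with $(\Sigma_\lambda i)\circ\lambda_{ji}=\Sigma_\lambda j$ and ${!}\circ\lambda_{ji}={!!}$. *)

(* Defs.v *)
Import EqNotations.

Set Implicit Arguments.
Unset Strict Implicit.
Unset Printing Implicit Defensive.

Declare Scope fam_scope.
Delimit Scope fam_scope with fam.
Open Scope fam_scope.

Reserved Notation "f ∘ g" (at level 40, left associativity).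
Reserved Notation "l ⊙ f" (at level 40, left associativity).

Record Category := {
  obj :> Type;
  Hom : obj -> obj -> Type;
  idm : forall a, Hom a a;
  comp : forall c b a, Hom b a -> Hom c b -> Hom c a
    where "f ∘ g" := (comp f g) : fam_scope;
  comp1m : forall b a (f : Hom b a), idm a ∘ f = f;
  compm1 : forall b a (f : Hom b a), f ∘ idm b = f;
  compA : forall d c b a (f : Hom b a) (g : Hom c b) (h : Hom d c),
    f ∘ (g ∘ h) = (f ∘ g) ∘ h
}.

Notation "f ∘ g" := (comp f g) : fam_scope.
Arguments idm {C} a : rename.

Definition is_mono (C : Category) (b a : C) (f : Hom b a) : Prop :=
  forall (c : C) (g h : Hom c b), f ∘ g = f ∘ h -> g = h.

Definition are_inverse (C : Category) (a b : C) (f : Hom a b) (g : Hom b a)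
  : Prop := g ∘ f = idm a /\ f ∘ g = idm b.

(* The square
       p --q--> x
       |        |
       r        s
       v        v
       b --f--> a                                                           *)
Definition is_pullback (C : Category) (p x b a : C)
    (q : Hom p x) (r : Hom p b) (s : Hom x a) (f : Hom b a) : Prop :=
  s ∘ q = f ∘ r /\
  forall (c : C) (u : Hom c x) (v : Hom c b), s ∘ u = f ∘ v ->
    exists! h : Hom c p, q ∘ h = u /\ r ∘ h = v.

Record Terminal (C : Category) := {
  one :> C;
  bang : forall a : C, Hom a one;
  bang_unique : forall (a : C) (f : Hom a one), f = bang a
}.

Record FamCategory := {
  fam_cat :> Category;
  fHom : fam_cat -> Type;
  fcomp : forall b a : fam_cat, fHom a -> Hom b a -> fHom b
    where "l ⊙ f" := (fcomp l f) : fam_scope;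
  fcomp1 : forall (a : fam_cat) (l : fHom a), l ⊙ idm a = l;
  fcompA : forall (c b a : fam_cat) (l : fHom a) (f : Hom b a) (g : Hom c b),
    l ⊙ (f ∘ g) = (l ⊙ f) ⊙ g
}.

Notation "l ⊙ f" := (fcomp l f) : fam_scope.

(* The two sides of each strictness law have domains that are only
   propositionally equal, e.g. Sum (l ⊙ idm a) and Sum l; the left-hand sides
   are therefore transported along the laws of the action of arrows on
   families. *)
Record FamSigmaCategory := {
  fam_sigma_cat :> FamCategory;
  Sum : forall a : fam_sigma_cat, fHom a -> fam_sigma_cat;
  pr1 : forall (a : fam_sigma_cat) (l : fHom a), Hom (Sum l) a;
  Sig : forall (b a : fam_sigma_cat) (l : fHom a) (f : Hom b a),
    Hom (Sum (l ⊙ f)) (Sum l);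
  Sig_pullback : forall (b a : fam_sigma_cat) (l : fHom a) (f : Hom b a),
    is_pullback (Sig l f) (pr1 (l ⊙ f)) (pr1 l) f;
  Sig_id : forall (a : fam_sigma_cat) (l : fHom a),
    rew [fun m => Hom (Sum m) (Sum l)] fcomp1 l in Sig l (idm a)
    = idm (Sum l);
  Sig_comp : forall (c b a : fam_sigma_cat) (l : fHom a)
      (f : Hom b a) (g : Hom c b),
    rew [fun m => Hom (Sum m) (Sum l)] fcompA l f g in Sig l (f ∘ g)
    = Sig l f ∘ Sig (l ⊙ f) g
}.

Definition is_transport (C : FamSigmaCategory) (T : Terminal C) (a : C)
    (l : fHom a) (i j : Hom T a) (t : Hom (Sum (l ⊙ i)) (Sum (l ⊙ j)))
  : Prop :=
  Sig l j ∘ t = Sig l i /\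
  bang T (Sum (l ⊙ j)) ∘ t = bang T (Sum (l ⊙ i)).

(* Main.v *)
Require Import Defs.

(** Any arrow into the terminal object is monic, and [Sig l i] is the pullback
    of the global element [i] along [pr1 l], hence monic.  When [i = j] the
    identity arrow serves as transport in both directions. *)

Lemma terminal_hom_eq (C : Category) (T : Terminal C) (a : C) (f g : Hom a T) :
  f = g.
Proof. now rewrite (bang_unique f), (bang_unique g). Qed.

Lemma global_element_mono (C : Category) (T : Terminal C) (a : C)
    (i : Hom T a) : is_mono i.
Proof. intros c g h _; apply terminal_hom_eq. Qed.

(** Since [f ∘ r = s ∘ q], arrows equalised by [q] are equalised by [f ∘ r], hence by [r] as [f] is
    monic. Both then mediate the same cone, so uniqueness identifies them. *)
Lemma pullback_mono (C : Category) (p x b a : C)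
    (q : Hom p x) (r : Hom p b) (s : Hom x a) (f : Hom b a) :
  is_pullback q r s f -> is_mono f -> is_mono q.
Proof.
intros [sq univ] fmono c g h qgh.
assert (rgh : r ∘ g = r ∘ h).
{ apply fmono.
  now rewrite !compA, <- sq, <- !compA, qgh. }
assert (cone : s ∘ (q ∘ g) = f ∘ (r ∘ g)) by now rewrite !compA, sq.
destruct (univ c (q ∘ g) (r ∘ g) cone) as [k [_ kuniq]].
transitivity k; [symmetry|]; apply kuniq; split; congruence.
Qed.

Lemma is_transport_id (C : FamSigmaCategory) (T : Terminal C) (a : C)
    (l : fHom a) (i : Hom T a) :
  is_transport (i := i) (j := i) (idm (Sum (l ⊙ i))).
Proof. split; apply compm1. Qed.

Theorem proposition3p7 (C : FamSigmaCategory) (T : Terminal C) (a : C)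
    (l : fHom a) (i j : Hom T a) :
  (is_mono (Sig l i) /\ pr1 (l ⊙ i) = bang T (Sum (l ⊙ i))) /\
  (i = j ->
     exists (lij : Hom (Sum (l ⊙ i)) (Sum (l ⊙ j)))
            (lji : Hom (Sum (l ⊙ j)) (Sum (l ⊙ i))),
       is_transport lij /\ is_transport lji /\ are_inverse lij lji).
Proof.
split; [split|].
- apply (pullback_mono _ _ _ _ _ _ _ _ _ (Sig_pullback l i)).
  apply global_element_mono.
- apply bang_unique.
(* Replacing [j] by [i] makes the two sums the same object, so the identity has the required type
   without a cast along [i = j]. *)
- intros <-; exists (idm _), (idm _).
  split; [apply is_transport_id|split; [apply is_transport_id|]].
  split; apply comp1m.
Qed.
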